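(* Let $(G,\mathcal C)$ be a finite convex geometry of convex dimension $d$. Then $(G,\mathcal C)$ can be represented in $\mathbb R^d$ by ellipsoids that are arbitrarily close to a ball. That is, for every $\varepsilon>0$ there is a finite family $\mathscr K$ of ellipsoids in $\mathbb R^d$, each at Hausdorff distance less than $\varepsilon$ from the closed unit ball of $\mathbb R^d$, such that $(\mathscr K,\operatorname{conv}_{\mathscr K})$ is a convex geometry isomorphic to $(G,\mathcal C)$.
   Context: A convex geometry on a finite set $E$ is a collection $\mathcal C$ of subsets of $E$ (called convex sets) such that: $\emptyset,E\in\mathcal C$; $X,Y\in\mathcal C$ implies $X\cap Y\in\mathcal C$; and for every $X\in\mathcal C\setminus\{E\}$ there is $e\in E\setminus X$ with $X\cup\{e\}\in\mathcal C$. Equivalently, it is a pair $(E,\Phi)$ where $\Phi:2^E\to 2^E$ is a closure operator with $\Phi(\emptyset)=\emptyset$ satisfying the anti-exchange property: if $A\subseteq E$, $x,y\in E\setminus\Phi(A)$ and $\Phi(A\cup\{x\})=\Phi(A\cup\{y\})$, then $x=y$. The convex sets are the sets $X$ with $\Phi(X)=X$. Two convex geometries on $E_1$ and $E_2$ are isomorphic if there is a bijection $\varphi:E_1\to E_2$ such that $X\subseteq E_1$ is convex iff $\varphi(X)$ is convex. Orderings are total and antisymmetric. $(E,\mathcal C)$ is generated by orderings $\{\preccurlyeq_i\}_{i=1}^m$ ($m\ge1$) on $E$ if $$\mathcal C=\{\emptyset\}\cup\{X\subseteq E:\ \forall y\notin X\ \exists i\ \forall x\in X,\ x\prec_i y\}.$$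 The convex dimension of $(E,\mathcal C)$ is the smallest number $m\ge 1$ of orderings generating it (such families of orderings always exist). For a finite family $\mathscr K$ of compact convex sets in $\mathbb R^d$ and $\mathscr S\subseteq\mathscr K$, $$\operatorname{conv}_{\mathscr K}(\mathscr S)=\Big\{K\in\mathscr K:\ K\subseteq\operatorname{conv}\Big(\bigcup_{S\in\mathscr S}S\Big)\Big\},$$ where $\operatorname{conv}$ is the usual convex hull in $\mathbb R^d$. Ellipsoids are solid, i.e. images of the closed unit ball under invertible affine maps. *)

(* Defs.v *)
From HB Require Import structures.
From mathcomp Require Import all_boot all_order all_algebra finmap.

Set Implicit Arguments.
Unset Strict Implicit.
Unset Printing Implicit Defensive.

Section ConvexGeometry.
Variable E : finType.

Definition convex_geometry (C : {set {set E}}) : Prop :=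
  [/\ set0 \in C,
      [set: E] \in C,
      (forall X Y : {set E}, X \in C -> Y \in C -> X :&: Y \in C) &
      (forall X : {set E}, X \in C -> X != [set: E] ->
         exists2 e, e \notin X & X :|: [set e] \in C)].

Definition closure_operator (Phi : {set E} -> {set E}) : Prop :=
  [/\ (forall A : {set E}, A \subset Phi A),
      (forall A B : {set E}, A \subset B -> Phi A \subset Phi B) &
      (forall A : {set E}, Phi (Phi A) = Phi A)].

Definition anti_exchange (Phi : {set E} -> {set E}) : Prop :=
  forall (A : {set E}) (x y : E), x \notin Phi A -> y \notin Phi A ->
    Phi (A :|: [set x]) = Phi (A :|: [set y]) -> x = y.

Definition closure_convex_geometry (Phi : {set E} -> {set E}) : Prop :=
  [/\ closure_operator Phi, Phi set0 = set0 & anti_exchange Phi].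

Definition convex_sets (Phi : {set E} -> {set E}) : {set {set E}} :=
  [set X | Phi X == X].

Definition total_ordering (r : rel E) : Prop :=
  [/\ reflexive r, antisymmetric r, transitive r & total r].

Definition strict (r : rel E) : rel E := fun x y => r x y && (x != y).

Definition generated_by m (r : 'I_m -> rel E) : {set {set E}} :=
  set0 |: [set X : {set E} |
    [forall y, (y \notin X) ==>
       [exists i, [forall x in X, strict (r i) x y]]]].

Definition generable C m : Prop :=
  exists2 r : 'I_m -> rel E,
    (forall i, total_ordering (r i)) & C = generated_by r.

Definition has_convex_dimension C d : Prop :=
  [/\ 0 < d, generable C d & forall m, 0 < m -> generable C m -> d <= m].

End ConvexGeometry.

Definition isomorphic_geometries (E1 E2 : finType)
    (C1 : {set {set E1}}) (C2 : {set {set E2}}) : Prop :=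
  exists2 f : E1 -> E2,
    bijective f & forall X : {set E1}, (X \in C1) = (f @: X \in C2).

From mathcomp Require Import all_classical all_reals all_analysis.
Import Order.TTheory GRing.Theory Num.Theory.

Local Open Scope classical_set_scope.
Local Open Scope ring_scope.

Section EuclideanSpace.
Variables (R : realType) (d : nat).
Local Notation V := 'cV[R]_d.

Definition convex_hull (A : set V) : set V := smallest (@convex_set R V) A.

(* The library norm on matrices is the sup norm. *)
Definition euclidean_norm (x : V) : R := Num.sqrt (\sum_i x i 0 ^+ 2).

Definition unit_ball : set V := [set x | euclidean_norm x <= 1].

Definition ellipsoid (K : set V) : Prop :=
  exists (A : 'M[R]_d) (b : V),
    A \in unitmx /\ K = [set A *m x + b | x in unit_ball].

Definition hausdorff_distance (A B : set V) : \bar R :=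
  let dist x y := (euclidean_norm (x - y))%:E in
  Order.max (ereal_sup [set ereal_inf [set dist x y | y in B] | x in A])
            (ereal_sup [set ereal_inf [set dist x y | x in A] | y in B]).

(* A finite family of subsets of R^d is a finite set [K] of such subsets,
   viewed as the finite type of its members. *)
Definition conv_family (K : {fset set V}) (S : {set K}) : {set K} :=
  finset (fun L : K =>
    `[< val L `<=` convex_hull (\bigcup_(M in [set` S]) val M) >]).

End EuclideanSpace.

Arguments unit_ball : clear implicits.

(* Main.v *)
(** Let the geometry be generated by d orderings, so that g lies in the closure
of S iff for every i some s in S satisfies g <=_i s.  Represent g by the
ellipsoid centred at 0 whose i-th semi-axis is an increasing function of the
rank of g in the i-th ordering.  If every s in S precedes g for the i-th
ordering, then the i-th coordinate separates the ellipsoid of g from the hull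
of those of S.  Conversely, if the squared semi-axes grow fast enough with the
rank and s_i follows g for the i-th ordering, then the squared semi-axes of g
are bounded by the means of those of s_1, ..., s_d, and this forces the
ellipsoid of g into the convex hull of those of the s_i.  Scaling the growth
down keeps all semi-axes within [1, 1 + eps / 2]. *)

Require Import Defs.
From HB Require Import structures.
From mathcomp Require Import all_boot all_order all_algebra finmap.
From mathcomp Require Import all_classical all_reals all_analysis.
From mathcomp Require Import ring lra.

Set Implicit Arguments.
Unset Strict Implicit.
Unset Printing Implicit Defensive.

Import Order.TTheory GRing.Theory Num.Theory.

Local Open Scope ring_scope.

(** * The closure operator attached to a family of orderings *)

Section OrderingClosure.
Variables (E : finType) (m : nat) (r : 'I_m -> rel E).

Definition ordering_closure (S : {set E}) : {set E} :=
  finset (fun y => [forall i, [exists x in S, r i y x]]).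

Lemma ordering_closureP (S : {set E}) (y : E) :
  reflect (forall i, exists2 x, x \in S & r i y x) (y \in ordering_closure S).
Proof. by rewrite finset.in_set; apply: 'forall_exists_inP. Qed.

Hypothesis m_gt0 : (0 < m)%N.
Hypothesis r_total : forall i, total_ordering (r i).

Lemma strictN i x y : strict (r i) x y = ~~ r i y x.
Proof.
have [rr ra _ rt] := r_total i; rewrite /strict.
have [->|xy] := eqVneq x y; first by rewrite rr andbF.
rewrite andbT; apply/idP/idP => [rxy|].
  by apply/negP => ryx; case/eqP: xy; apply: ra; rewrite rxy.
by move=> /negbTE nyx; have := rt x y; rewrite nyx orbF.
Qed.

Lemma ordering_closurePn (S : {set E}) (y : E) :
  reflect (exists i, forall x, x \in S -> strict (r i) x y)
          (y \notin ordering_closure S).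
Proof.
rewrite finset.in_set negb_forall; apply: (iffP existsP) => -[i Hi]; exists i.
  move: Hi; rewrite negb_exists_in => /forall_inP Hi x xS.
  by rewrite strictN Hi.
by rewrite negb_exists_in; apply/forall_inP => x /Hi; rewrite strictN.
Qed.

(** For anti-exchange, choose an ordering [i] that puts [x] strictly above all of [A]. Then [x] can
    lie in the closure of [A] and [y] only through [x <=_i y]. Now [y] cannot lie below an element
    of [A], so [y <=_i x] as well, and antisymmetry concludes. *)
Lemma ordering_closure_convex_geometry :
  closure_convex_geometry ordering_closure.
Proof.
split; first split.
- move=> A; apply/fintype.subsetP => y yA; apply/ordering_closureP => i.
  by exists y => //; have [rr _ _ _] := r_total i; apply: rr.
- move=> A B /fintype.subsetP AB; apply/fintype.subsetP => y /ordering_closureP yA.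
  apply/ordering_closureP => i; have [x xA yx] := yA i.
  by exists x => //; apply: AB.
- move=> A; apply/eqP; rewrite finset.eqEsubset; apply/andP; split.
    apply/fintype.subsetP => y /ordering_closureP yA; apply/ordering_closureP => i.
    have [x /ordering_closureP xA yx] := yA i; have [z zA xz] := xA i.
    by exists z => //; have [_ _ rt _] := r_total i; apply: rt xz.
  apply/fintype.subsetP => y yA; apply/ordering_closureP => i.
  by exists y => //; have [rr _ _ _] := r_total i; apply: rr.
(* An actual ordering, supplied by [m_gt0], is what keeps the closure of the empty set empty. *)
- apply/finset.setP => y; rewrite finset.in_set0; apply/negP => /ordering_closureP.
  by move=> /(_ (Ordinal m_gt0))[x]; rewrite finset.in_set0.
- move=> A x y /ordering_closurePn[i xA] _ AxAy.
  have xAx : x \in ordering_closure (A :|: [set x]).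
    apply/ordering_closureP => j; exists x; first by rewrite !inE eqxx orbT.
    by have [rr _ _ _] := r_total j; apply: rr.
  have yAy : y \in ordering_closure (A :|: [set y]).
    apply/ordering_closureP => j; exists y; first by rewrite !inE eqxx orbT.
    by have [rr _ _ _] := r_total j; apply: rr.
  have [_ ra rt _] := r_total i.
  rewrite AxAy in xAx; rewrite -AxAy in yAy.
  have rxy : r i x y.
    have [z] := ordering_closureP _ _ xAx i.
    by rewrite !inE => /orP[/xA|/eqP->//]; rewrite strictN => /negbTE->.
  have [z] := ordering_closureP _ _ yAy i.
  rewrite !inE => /orP[zA yz|/eqP-> ryx]; last by apply: ra; rewrite rxy ryx.
  by have := xA z zA; rewrite strictN (rt y).
Qed.

(** By totality, being outside the closure of [X] is exactly the separation condition in
    [generated_by]. The empty set is treated apart because [generated_by] adjoins it by hand. *)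
Lemma convex_sets_ordering_closure :
  convex_sets ordering_closure = generated_by r.
Proof.
have [[ext _ _] Phi0 _] := ordering_closure_convex_geometry.
apply/finset.setP => X; rewrite !inE; have [->|X0] := eqVneq X finset.set0.
  by rewrite Phi0 eqxx.
rewrite orFb finset.eqEsubset ext andbT; apply/fintype.subsetP/forall_inP => [XX y yX|XX y].
  have /ordering_closurePn[i yi] : y \notin ordering_closure X.
    by apply: contra yX => /XX.
  by apply/existsP; exists i; apply/forall_inP.
apply: contraLR => /XX/existsP[i /forall_inP yi].
by apply/ordering_closurePn; exists i.
Qed.

End OrderingClosure.

(** * Transport of closure operators along a bijection *)

Section Transport.
Variables (E1 E2 : finType) (f : E1 -> E2).
Variables (Phi1 : {set E1} -> {set E1}) (Phi2 : {set E2} -> {set E2}).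
Hypothesis f_bij : bijective f.
Hypothesis fPhi : forall S : {set E1}, Phi2 (f @: S) = f @: Phi1 S.

Lemma imset_bij_surj (A : {set E2}) : exists B : {set E1}, A = f @: B.
Proof.
by case: f_bij => g fK gK; exists (g @: A); rewrite -finset.imset_comp
  (eq_imset _ (g := id)) ?finset.imset_id// => x /=; rewrite gK.
Qed.

(** Every subset of [E2] is an image under [f], so each axiom pulls back through [fPhi]. *)
Lemma closure_convex_geometry_transport :
  closure_convex_geometry Phi1 -> closure_convex_geometry Phi2.
Proof.
have f_inj := bij_inj f_bij.
move=> [[ext mono idem] Phi0 anti]; split; first split.
- by move=> A; have [B ->] := imset_bij_surj A; rewrite fPhi imsetS.
- move=> A A'; have [B ->] := imset_bij_surj A; have [B' ->] := imset_bij_surj A'.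
  by rewrite !fPhi => BB'; apply/imsetS/mono/fintype.subsetP => x xB;
    move/fintype.subsetP: BB' => /(_ (f x)); rewrite !mem_imset//; apply.
- by move=> A; have [B ->] := imset_bij_surj A; rewrite !fPhi idem.
- by rewrite -(imset0 f) fPhi Phi0.
- move=> A x' y'; have [B ->] := imset_bij_surj A; case: (f_bij) => g fK gK.
  rewrite -(gK x') -(gK y'); set x := g x'; set y := g y'.
  rewrite -!(imset_set1 f) -!finset.imsetU !fPhi !mem_imset//.
  by move=> xB yB /(imset_inj f_inj)/anti ->.
Qed.

Lemma isomorphic_convex_sets :
  isomorphic_geometries (convex_sets Phi1) (convex_sets Phi2).
Proof.
exists f => // X; rewrite !inE fPhi; apply/eqP/eqP => [->//|].
by move/(finset.imset_inj (bij_inj f_bij)) => ->.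
Qed.

End Transport.

(** * Convex hulls and subconvex combinations *)

Section ConvexHull.
Variables (R : realType) (d : nat).
Local Notation V := 'cV[R]_d.
Local Open Scope classical_set_scope.

Lemma convex_setE (D : set V) :
  @convex_set R V D <->
  forall x y t, D x -> D y -> 0 <= t -> t <= 1 -> D (t *: x + (1 - t) *: y).
Proof.
split=> [cD x y t Dx Dy t0 t1|cD x y t].
  by have := cD x y (Itv01 t0 t1); rewrite !inE; apply.
by rewrite !inE => Dx Dy; apply: cD.
Qed.

Lemma sub_convex_hull (A : set V) : A `<=` convex_hull A.
Proof. exact: sub_gen_smallest. Qed.

Lemma convex_hull_min (A D : set V) :
  @convex_set R V D -> A `<=` D -> convex_hull A `<=` D.
Proof. exact: smallest_sub. Qed.

Lemma convex_convex_hull (A : set V) : @convex_set R V (convex_hull A).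
Proof.
apply/convex_setE => x y t Ax Ay t0 t1 D [cD AD].
by move/convex_setE: (cD); apply => //; [apply: Ax|apply: Ay].
Qed.

Lemma convex_hull_subset (A B : set V) :
  A `<=` B -> convex_hull A `<=` convex_hull B.
Proof.
move=> AB; apply: convex_hull_min; first exact: convex_convex_hull.
exact: subset_trans AB (@sub_convex_hull B).
Qed.

(** By induction the sum is its total weight times a single point [p] of [D]; a total weight below 1
    is then made up by mixing [p] with 0. *)
Lemma convex_set_sum (D : set V) (J : Type) (s : seq J) (w : J -> R) (z : J -> V) :
  @convex_set R V D -> D 0 -> (forall j, 0 <= w j) -> (forall j, D (z j)) ->
  \sum_(j <- s) w j <= 1 -> D (\sum_(j <- s) w j *: z j).
Proof.
move=> /convex_setE cD D0 w0 Dz w1.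
have [p Dp ->] : exists2 p, D p &
    \sum_(j <- s) w j *: z j = (\sum_(j <- s) w j) *: p.
  elim: s {w1} => [|j s [p Dp IH]]; first by exists 0; rewrite ?big_nil ?scaler0.
  rewrite !big_cons IH; set W := \sum_(i <- s) w i.
  have W0 : 0 <= W by apply: sumr_ge0.
  (* With zero total weight nothing can be normalised, but both terms vanish and 0 serves as the
     point. *)
  have [/eqP|u0] := eqVneq (w j + W) 0.
    rewrite paddr_eq0// => /andP[/eqP -> /eqP ->].
    by exists 0; rewrite // !scale0r addr0 scaler0.
  exists ((w j / (w j + W)) *: z j + (1 - w j / (w j + W)) *: p).
    apply: cD => //; first by rewrite divr_ge0 ?addr_ge0.
    by rewrite ler_pdivrMr ?mul1r ?lerDl// lt_def u0 addr_ge0.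
  rewrite scalerDr !scalerA; congr (_ *: _ + _ *: _); first by field.
  by field.
have := cD p 0 _ Dp D0 (sumr_ge0 _ (fun j _ => w0 j)) w1.
by rewrite scaler0 addr0.
Qed.

End ConvexHull.

(** * Axis-parallel ellipsoids: gauges, hulls and Hausdorff distance *)

Section Ellipsoids.
Variables (R : realType) (d : nat).
Local Notation V := 'cV[R]_d.
Local Open Scope classical_set_scope.

Lemma unit_ballE (x : V) : unit_ball R d x = (\sum_i x i 0 ^+ 2 <= 1).
Proof.
by congr is_true; rewrite /= -[X in _ <= X]sqrtr1 ler_sqrt.
Qed.

Definition axis_ellipsoid (a : 'I_d -> R) : set V :=
  [set x : V | \sum_i (x i 0 / a i) ^+ 2 <= 1].

Lemma axis_ellipsoidE (a : 'I_d -> R) : (forall i, 0 < a i) ->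
  axis_ellipsoid a =
  [set diag_mx (\row_i a i) *m x + 0 | x in unit_ball R d].
Proof.
move=> a0; apply/seteqP; split=> x /=.
  move=> xa; exists (\col_i (x i 0 / a i)).
    by rewrite unit_ballE; under eq_bigr do rewrite mxE.
  apply/matrixP => i j; rewrite ord1 mul_diag_mx !mxE addr0 mulrCA divff ?mulr1//.
  by rewrite gt_eqF.
case=> y + <-; rewrite unit_ballE => y1; rewrite /axis_ellipsoid /=.
under eq_bigr => i _ do
  rewrite mul_diag_mx !mxE addr0 mulrAC divff ?gt_eqF// mul1r.
exact: y1.
Qed.

Lemma ellipsoid_axis_ellipsoid (a : 'I_d -> R) : (forall i, 0 < a i) ->
  ellipsoid (axis_ellipsoid a).
Proof.
move=> a0; exists (diag_mx (\row_i a i)), 0; split; last exact: axis_ellipsoidE.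
rewrite unitmxE det_diag unitfE prodf_seq_neq0; apply/allP => i _ /=.
by rewrite mxE gt_eqF.
Qed.

Lemma axis_ellipsoid0 (a : 'I_d -> R) : axis_ellipsoid a 0.
Proof.
rewrite /axis_ellipsoid /= big1 ?ler01// => i _.
by rewrite mxE mul0r expr0n.
Qed.

Lemma gauge_axis_ellipsoid (a : 'I_d -> R) (y : V) : (forall i, 0 < a i) ->
  exists2 z, axis_ellipsoid a z &
    y = Num.sqrt (\sum_i (y i 0 / a i) ^+ 2) *: z.
Proof.
move=> a0; set q := \sum_i _; set s := Num.sqrt q.
have q0 : 0 <= q by apply: sumr_ge0 => i _; apply: sqr_ge0.
have s2 : s ^+ 2 = q by rewrite sqr_sqrtr.
(* [s] is the gauge of [y]. A zero gauge forces [y = 0]; otherwise [y] is rescaled to gauge 1. *)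
have [s0|s0] := eqVneq s 0.
  exists 0; first exact: axis_ellipsoid0.
  rewrite scaler0; apply/matrixP => i j; rewrite ord1 [RHS]mxE.
  move/eqP: s2; rewrite s0 expr0n eq_sym psumr_eq0 => [|k _]; last exact: sqr_ge0.
  move/allP => /(_ i); rewrite mem_index_enum => /(_ isT)/=.
  by rewrite sqrf_eq0 mulf_eq0 invr_eq0 (gt_eqF (a0 i)) orbF => /eqP.
exists (s^-1 *: y); last by rewrite scalerA divff ?scale1r.
rewrite /axis_ellipsoid /=.
under eq_bigr => i _ do rewrite mxE -mulrA exprMn.
by rewrite -mulr_sumr -/q -s2 exprVn mulVf// expf_neq0.
Qed.

(* Writing c for the weighted mean of the a_j^2, a point x of the small
   ellipsoid is the weighted mean of the points y_j = (a_j^2 / c) x, whose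
   squared gauges average to at most 1; so rescaling each y_j to its own
   ellipsoid gives weights w_j * gauge(y_j) of total at most 1. *)
Lemma axis_ellipsoid_sub_convex_hull (J : finType) (w : J -> R)
    (a : J -> 'I_d -> R) (b : 'I_d -> R) :
    (forall j, 0 <= w j) -> \sum_j w j = 1 ->
    (forall j i, 0 < a j i) -> (forall i, 0 < b i) ->
    (forall i, b i ^+ 2 <= \sum_j w j * a j i ^+ 2) ->
  axis_ellipsoid b `<=` convex_hull (\bigcup_j axis_ellipsoid (a j)).
Proof.
move=> w0 w1 a0 b0 ba x xb.
pose c i := \sum_j w j * a j i ^+ 2.
have c0 i : 0 < c i by apply: lt_le_trans (ba i); rewrite exprn_gt0.
pose y j : V := \col_i (a j i ^+ 2 * x i 0 / c i).
pose q j := \sum_i (y j i 0 / a j i) ^+ 2.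
have q0 j : 0 <= q j by apply: sumr_ge0 => i _; apply: sqr_ge0.
have xE : x = \sum_j w j *: y j.
  apply/matrixP => i k; rewrite ord1 summxE.
  transitivity (\sum_j w j * a j i ^+ 2 * (x i 0 / c i)).
    by rewrite -mulr_suml -/(c i) mulrCA divff ?mulr1 ?gt_eqF.
  by apply: eq_bigr => j _; rewrite !mxE; field; rewrite gt_eqF.
have wq : \sum_j w j * q j <= 1.
  under eq_bigr => j _ do rewrite mulr_sumr.
  rewrite exchange_big /=; apply: le_trans xb; apply: ler_sum => i _.
  (* Summing over [j] reproduces [c i], which cancels one of the two factors [c i] in the
     denominator; what remains is compared with [x i 0 ^+ 2 / b i ^+ 2]. *)
  have -> : \sum_j w j * (y j i 0 / a j i) ^+ 2 = x i 0 ^+ 2 / c i.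
    transitivity (\sum_j w j * a j i ^+ 2 * (x i 0 ^+ 2 / c i ^+ 2)).
      apply: eq_bigr => j _; rewrite mxE; field.
      by rewrite (gt_eqF (c0 i)) (gt_eqF (a0 j i)).
    by rewrite -mulr_suml -/(c i); field; rewrite gt_eqF.
  rewrite expr_div_n ler_wpM2l ?sqr_ge0// lef_pV2 ?posrE ?exprn_gt0//.
have /choice[z zP] j : exists z, axis_ellipsoid (a j) z /\
    y j = Num.sqrt (q j) *: z.
  by have [z] := gauge_axis_ellipsoid (y j) (a0 j); exists z.
have subhull j : axis_ellipsoid (a j) `<=`
    convex_hull (\bigcup_j axis_ellipsoid (a j)).
  by move=> v va; apply: sub_convex_hull; exists j.
rewrite xE; under eq_bigr => j _ do rewrite (zP j).2 scalerA.
apply: (@convex_set_sum _ _ (convex_hull _) _ _ (fun j => w j * Num.sqrt (q j)) z).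
- exact: convex_convex_hull.
- have [j _|J0] := pickP (@predT J); last first.
    by have := @oner_neq0 R; rewrite -w1 big_pred0 ?eqxx.
  by apply: (subhull j); exact: axis_ellipsoid0.
- by move=> j; rewrite mulr_ge0 ?sqrtr_ge0.
- by move=> j; apply: (subhull j); have [] := zP j.
(* The square roots are removed by [sqrt q <= (1 + q) / 2], that is, [0 <= (sqrt q - 1)^2]. *)
- apply: (@le_trans _ _ (\sum_j (w j + w j * q j) / 2)).
    apply: ler_sum => j _; have := w0 j; have := sqr_sqrtr (q0 j).
    set s := Num.sqrt _ => <- wj0.
    have := mulr_ge0 wj0 (sqr_ge0 (s - 1)); lra.
  by rewrite -mulr_suml big_split /= w1; lra.
Qed.

Lemma convex_open_slab (i : 'I_d) (t : R) :
  @convex_set R V [set x : V | x i 0 < t].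
Proof.
apply/convex_setE => x y s /= xt yt s0 s1; rewrite !mxE.
have [->|s_neq0] := eqVneq s 0; first by rewrite mul0r subr0 mul1r add0r.
have sgt0 : 0 < s by rewrite lt_def s_neq0.
nra.
Qed.

Lemma axis_ellipsoid_coord_le (a : 'I_d -> R) (x : V) i : (forall i, 0 < a i) ->
  axis_ellipsoid a x -> x i 0 <= a i.
Proof.
move=> a0; rewrite /axis_ellipsoid /= (bigD1 i)//= => x1.
have : (x i 0 / a i) ^+ 2 <= 1.
  apply: le_trans x1; rewrite lerDl.
  by apply: sumr_ge0 => j _; apply: sqr_ge0.
suff : x i 0 / a i <= 1 -> x i 0 <= a i.
  by set u := x i 0 / a i => + u1; apply; have := sqr_ge0 (u - 1); lra.
by rewrite ler_pdivrMr// mul1r.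
Qed.

Lemma axis_ellipsoid_vertex (a : 'I_d -> R) i : (forall i, 0 < a i) ->
  axis_ellipsoid a (a i *: delta_mx i 0).
Proof.
move=> a0; rewrite /axis_ellipsoid /= (bigD1 i)//= big1 => [|j ji].
  by rewrite !mxE !eqxx mulr1 addr0 divff ?expr1n ?gt_eqF.
by rewrite !mxE (negbTE ji) mulr0 mul0r expr0n.
Qed.

(** The open half-space [x_i < b_i] contains the whole hull but misses the vertex of the large
    ellipsoid on the [i]-th axis. *)
Lemma axis_ellipsoid_not_sub_convex_hull (J : Type) (P : set J)
    (a : J -> 'I_d -> R) (b : 'I_d -> R) (i : 'I_d) :
    (forall j i, 0 < a j i) -> (forall i, 0 < b i) ->
    (forall j, P j -> a j i < b i) ->
  ~ axis_ellipsoid b `<=` convex_hull (\bigcup_(j in P) axis_ellipsoid (a j)).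
Proof.
move=> a0 b0 ab /(_ _ (axis_ellipsoid_vertex i b0)).
move/(convex_hull_min (@convex_open_slab i (b i))) => /=.
rewrite !mxE !eqxx mulr1 ltxx => H; suff : false by []; apply: H.
move=> x [j Pj] /(axis_ellipsoid_coord_le i (a0 j)) /=.
by move/le_lt_trans; apply; apply: ab.
Qed.

Lemma hausdorff_distance_le (A B : set V) (eta : R) :
    (forall x, A x -> exists2 y, B y & euclidean_norm (x - y) <= eta) ->
    (forall y, B y -> exists2 x, A x & euclidean_norm (x - y) <= eta) ->
  (hausdorff_distance A B <= eta%:E)%E.
Proof.
move=> AB BA; rewrite /hausdorff_distance ge_max; apply/andP; split.
  apply: ge_ereal_sup => _ [x Ax <-]; have [y By xy] := AB x Ax.
  by apply: ge_ereal_inf; exists (euclidean_norm (x - y))%:E => //;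
    exists y.
apply: ge_ereal_sup => _ [y By <-]; have [x Ax xy] := BA y By.
by apply: ge_ereal_inf; exists (euclidean_norm (x - y))%:E => //;
  exists x.
Qed.

(** Pairing each [y] in the ball with its image under the diagonal map serves both directions: the
    displacement has coordinates [(a i - 1) * y i], hence norm at most [eta]. *)
Lemma hausdorff_distance_axis_ellipsoid (a : 'I_d -> R) (eta : R) :
    0 <= eta -> (forall i, 1 <= a i <= 1 + eta) ->
  (hausdorff_distance (axis_ellipsoid a) (unit_ball R d) <= eta%:E)%E.
Proof.
move=> eta0 a1.
have a0 i : 0 < a i by have /andP[/(lt_le_trans ltr01)] := a1 i.
have dist y : unit_ball R d y ->
    euclidean_norm (diag_mx (\row_i a i) *m y + 0 - y) <= eta.
  rewrite unit_ballE /euclidean_norm => y1.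
  rewrite -[X in _ <= X](ger0_norm eta0) -sqrtr_sqr ler_wsqrtr//.
  apply: (@le_trans _ _ (\sum_i eta ^+ 2 * y i 0 ^+ 2)).
    apply: ler_sum => i _; rewrite mul_diag_mx !mxE addr0.
    have -> : a i * y i 0 - y i 0 = (a i - 1) * y i 0 by ring.
    rewrite exprMn ler_wpM2r ?sqr_ge0// lerXn2r ?nnegrE//.
      by have /andP[? _] := a1 i; rewrite subr_ge0.
    by have /andP[_ ?] := a1 i; rewrite lerBlDl.
  by rewrite -mulr_sumr ler_piMr ?sqr_ge0.
apply: hausdorff_distance_le; rewrite axis_ellipsoidE//.
  by move=> _ [y By <-]; exists y => //; apply: dist.
move=> y By; exists (diag_mx (\row_i a i) *m y + 0); last exact: dist.
by exists y.
Qed.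

End Ellipsoids.

(** * Semi-axes growing fast with the rank *)

Section FastRadii.
Variables (R : realType) (G : finType) (d : nat) (r : 'I_d -> rel G).
Hypothesis r_total : forall i, total_ordering (r i).

Definition ordering_rank (i : 'I_d) (g : G) : nat :=
  #|[pred x | strict (r i) x g]|.

Lemma ordering_rank_le i g : (ordering_rank i g <= #|G|)%N.
Proof. exact: max_card. Qed.

Lemma ltn_ordering_rank i g h :
  strict (r i) g h -> (ordering_rank i g < ordering_rank i h)%N.
Proof.
have [rr ra rt _] := r_total i.
move=> gh; apply: proper_card; apply/properP; split; last first.
  by exists g; rewrite !inE// /strict eqxx andbF.
apply/fintype.subsetP => x; rewrite !inE => /andP[xg _].
have /andP[gh' _] := gh; rewrite /strict (rt _ _ _ xg gh') /=.
by apply: contraTneq gh => xh; rewrite strictN// -xh xg.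
Qed.

(* The excess of the squared radius over 1 is multiplied by d + 1 > d at each
   rank, so among d elements a single one above g in the i-th ordering suffices
   for the mean of the i-th excesses to exceed that of g. *)
Definition radius (delta : R) (g : G) (i : 'I_d) : R :=
  Num.sqrt (1 + delta * d.+1%:R ^+ ordering_rank i g).

Variable delta : R.
Hypothesis delta_gt0 : 0 < delta.

Lemma sqr_radius g i :
  radius delta g i ^+ 2 = 1 + delta * d.+1%:R ^+ ordering_rank i g.
Proof. by rewrite sqr_sqrtr// addr_ge0// mulr_ge0 ?exprn_ge0// ltW. Qed.

Lemma radius_ge1 g i : 1 <= radius delta g i.
Proof.
rewrite -[X in X <= _]sqrtr1 ler_wsqrtr// lerDl.
by rewrite mulr_ge0 ?exprn_ge0// ltW.
Qed.

Lemma radius_gt0 g i : 0 < radius delta g i.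
Proof. exact: lt_le_trans (radius_ge1 g i). Qed.

Lemma radius_le g i : radius delta g i <= 1 + delta * d.+1%:R ^+ #|G|.
Proof.
have [a1 a2] := (radius_ge1 g i, sqr_radius g i).
(* A radius is at least 1, so it is bounded by its square, which is free of the root. *)
apply: (@le_trans _ _ (radius delta g i ^+ 2)); first by rewrite ler_eXnr.
rewrite a2 lerD2l ler_pM2l// ler_eXn2l ?ordering_rank_le//.
by rewrite ltr1n ltnS (leq_trans _ (ltn_ord i)).
Qed.

Lemma radius_lt g h i : strict (r i) g h -> radius delta g i < radius delta h i.
Proof.
move=> /ltn_ordering_rank gh.
rewrite -(ltr_pXn2r (n := 2))// ?nnegrE ?ltW ?radius_gt0//.
rewrite !sqr_radius ltrD2l ltr_pM2l// ltr_eXn2l// ltr1n ltnS.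
exact: leq_trans (ltn_ord i).
Qed.

Lemma sqr_radius_le_mean (g : G) (s : 'I_d -> G) :
    (forall i, strict (r i) g (s i)) ->
  forall i, radius delta g i ^+ 2 <=
    \sum_j d%:R^-1 * radius delta (s j) i ^+ 2.
Proof.
move=> gs i.
have d0 : 0 < d%:R :> R by rewrite ltr0n (leq_trans _ (ltn_ord i)).
rewrite -mulr_sumr ler_pdivlMl//; under eq_bigr do rewrite sqr_radius.
rewrite big_split /= sumr_const card_ord sqr_radius mulrDr mulr1 lerD2l.
rewrite -mulr_sumr mulrCA ler_pM2l// (bigD1 i)//=.
have /ltn_ordering_rank := gs i => ranks.
apply: (@le_trans _ _ (d.+1%:R ^+ ordering_rank i (s i))).
  (* The one extra rank contributes a factor [d + 1], which absorbs the [d] of the mean; the terms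
     with [j] other than [i] are only needed to be nonnegative. *)
  apply: (@le_trans _ _ (d.+1%:R ^+ (ordering_rank i g).+1)).
    by rewrite exprS ler_wpM2r ?exprn_ge0// ler_nat.
  by rewrite ler_weXn2l// ler1n.
by rewrite lerDl sumr_ge0// => j _; rewrite exprn_ge0.
Qed.

Lemma axis_ellipsoid_sub_ordering_closure (S : {set G}) (g : G) : (0 < d)%N ->
  (axis_ellipsoid (radius delta g) `<=`
     convex_hull (\bigcup_(s in [set` S]) axis_ellipsoid (radius delta s)))%classic
  <-> g \in ordering_closure r S.
Proof.
move=> d0; split=> [sub|].
  apply: contrapT => /negP/ordering_closurePn[//|i Si]; move: sub.
  apply: (axis_ellipsoid_not_sub_convex_hull (i := i)).
  - by move=> *; apply: radius_gt0.
  - by move=> *; apply: radius_gt0.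
  - by move=> s /Si; apply: radius_lt.
(* Outside [S], the witnesses [s i] differ from [g], so they follow it strictly and the mean bound
   applies with uniform weights [1 / d]. *)
have [gS _|gNS /ordering_closureP gS] := boolP (g \in S).
  by move=> x gx; apply: sub_convex_hull; exists g.
have /choice[s sP] i : exists x, x \in S /\ r i g x.
  by have [x xS gx] := gS i; exists x.
have gs i : strict (r i) g (s i).
  by have [sS gx] := sP i; rewrite /strict gx; apply: contraNneq gNS => ->.
have sub : (\bigcup_i axis_ellipsoid (radius delta (s i)) `<=`
    \bigcup_(s in [set` S]) axis_ellipsoid (radius delta s))%classic.
  by move=> x [i _ xi]; exists (s i) => //; have [] := sP i.
move=> x gx; apply: (convex_hull_subset sub); move: x gx.
apply: (@axis_ellipsoid_sub_convex_hull _ _ _ (fun=> d%:R^-1)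
  (fun i => radius delta (s i))).
- by [].
- by rewrite sumr_const card_ord -[LHS]mulr_natr mulVf// pnatr_eq0 -lt0n.
- by move=> *; apply: radius_gt0.
- by move=> *; apply: radius_gt0.
- exact: sqr_radius_le_mean.
Qed.

End FastRadii.

Theorem theorem6p1 (R : realType) (G : finType) (C : {set {set G}}) (d : nat)
    (hC : convex_geometry C) (hd : has_convex_dimension C d)
    (eps : R) (heps : 0 < eps) :
  exists K : {fset set 'cV[R]_d},
    [/\ (forall E : set 'cV[R]_d, E \in K ->
           ellipsoid E /\
           (hausdorff_distance E (unit_ball R d) < eps%:E)%E),
        closure_convex_geometry (@conv_family R d K) &
        isomorphic_geometries C (convex_sets (@conv_family R d K))].
Proof.
have [d0 [r r_total ->] _] := hd.
pose M : R := d.+1%:R ^+ #|G|.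
have M0 : 0 < M by rewrite exprn_gt0.
(* Chosen so that [delta * M = eps / 2]; [radius_le] then bounds all semi-axes by [1 + eps / 2]. *)
pose delta := eps / 2 / M.
have delta0 : 0 < delta by rewrite !divr_gt0.
pose F g : set 'cV[R]_d := axis_ellipsoid (radius r delta g).
(* One ordering already tells the ellipsoids apart: if [h'] strictly preceded [g'], the vertex of
   [F g'] on axis [i] would lie outside [F h']. *)
have F_inj : injective F.
  move=> g h FE; pose i := Ordinal d0.
  have le g' h' : F g' = F h' -> r i g' h'.
    move=> FE'; rewrite -[r i g' h']negbK -strictN//; apply/negP.
    move=> /(radius_lt r_total delta0); apply/negP; rewrite -leNgt.
    have := axis_ellipsoid_vertex i (radius_gt0 r delta0 g').
    rewrite -/(F g') FE' => /(axis_ellipsoid_coord_le i (radius_gt0 r delta0 h')).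
    by rewrite !mxE !eqxx mulr1.
  by have [_ ra _ _] := r_total i; apply: ra; rewrite !le.
pose K : {fset set 'cV[R]_d} := [fset F g | g in G]%fset.
have FK g : F g \in K by apply/imfsetP; exists g.
pose f g : K := [` FK g]%fset.
have f_bij : bijective f.
  apply: inj_card_bij; first by move=> g h /(congr1 val)/F_inj.
  by rewrite -cardfE card_imfset//= cardE.
(* The hull operator on the ellipsoids is conjugate under [f] to the closure of the orderings, so
   both remaining conclusions follow by transport. *)
have fPhi (S : {set G}) : conv_family (f @: S) = f @: ordering_closure r S.
  apply/finset.setP => L; have [g' fK' gK'] := f_bij.
  rewrite -(gK' L); set g := g' L.
  rewrite mem_imset; last exact: bij_inj f_bij.
  rewrite finset.in_set; apply/asboolP/idP.
    move=> sub; apply/(axis_ellipsoid_sub_ordering_closure r_total delta0)=> //.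
    apply: subset_trans sub _; apply: convex_hull_subset.
    by move=> x [_ /imsetP[s sS ->] sx]; exists s.
  move/(axis_ellipsoid_sub_ordering_closure r_total delta0) => /(_ d0).
  move/subset_trans; apply; apply: convex_hull_subset.
  by move=> x [s sS sx]; exists (f s) => //; apply: imset_f.
exists K; split.
- move=> _ /imfsetP[g _ ->]; split.
    by apply: ellipsoid_axis_ellipsoid => i; apply: radius_gt0.
  (* Halving [eps] turns the non-strict distance bound into a strict one. *)
  apply: (@le_lt_trans _ _ (eps / 2)%:E); last first.
    by rewrite lte_fin ltr_pdivrMr// mulrDr mulr1 ltrDl.
  apply: hausdorff_distance_axis_ellipsoid => [|i]; first by rewrite ltW ?divr_gt0.
  rewrite radius_ge1//=; apply: le_trans (radius_le _ delta0 _ _) _.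
  by rewrite -/M /delta divfK// gt_eqF.
- apply: (closure_convex_geometry_transport f_bij fPhi).
  exact: ordering_closure_convex_geometry.
- rewrite -convex_sets_ordering_closure//.
  exact: isomorphic_convex_sets f_bij fPhi.
Qed.
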